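(* Let $X$ be a proper geodesic Gromov hyperbolic space with basepoint $o$, and let $\kappa$ be a sublinear function. There exists a constant $C\ge 1$ such that, for all distinct $a,b\in\partial_\infty X\cong\partial_\kappa X$, $$(a\mid b)_o\le r_o(a,b)\le (a\mid b)_o+C\,\kappa\bigl((a\mid b)_o\bigr)+C .$$ Consequently, $1+r_o(a,b)\asymp 1+(a\mid b)_o$ for all distinct $a,b$, and every logarithmic metric $d_{\log}$ on $\partial_\kappa X$ with admissible exponent $\theta>0$ satisfies $$d_{\log}(a,b)\asymp \frac{1}{\bigl(1+(a\mid b)_o\bigr)^{\theta}}$$ for all distinct $a,b$.
   Context: $A\asymp B$ means that there is a constant $c\ge1$, independent of the boundary points, with $c^{-1}B\le A\le cB$. Hyperbolic spaces and boundary. In a metric space, $(x\mid y)_p=\frac12(d(x,p)+d(y,p)-d(x,y))$. $X$ is $\delta$-hyperbolic if $(x\mid z)_p\ge\min\{(x\mid y)_p,(y\mid z)_p\}-\delta$ for all points; it is Gromov hyperbolic if this holds for some $\delta\ge 0$ (fixed). A $(q,Q)$-quasi-geodesic ($q\ge1,Q\ge0$) is a continuous map $\beta:I\to X$, $I\subseteq\mathbb R$ an interval, with $\frac1q|s-t|-Q\le d(\beta(s),\beta(t))\le q|s-t|+Q$. All quasi-geodesic rays ($I=[0,\infty)$) start at $o$. The visual boundary $\partial_\infty X$ is the set of quasi-geodesic rays from $o$ modulo finite Hausdorff distance of images; every class contains a geodesic ray. For distinct $a,b\in\partial_\infty X$, $(a\mid b)_o=\sup\liminf_{i,j\to\infty}(x_i\mid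 y_j)_o$, the supremum over sequences $x_i\to a$, $y_j\to b$ with $x_i,y_j\in X$; $(a\mid a)_o=\infty$. Sublinear Morse boundary. A sublinear function is $\kappa:[0,\infty)\to[1,\infty)$, increasing (non-strictly), concave, $\kappa(r)/r\to0$ as $r\to\infty$. Write $\|x\|=d(o,x)$. For closed $Z\subseteq X$, $\mathcal N_\kappa(Z,n)=\{x: d(x,Z)\le n\,\kappa(\|x\|)\}$. For a quasi-geodesic ray $\beta$ and $r>0$, $t_r=\min\{t:\|\beta(t)\|=r\}$, $\beta_r=\beta(t_r)$, $\beta|_r=\beta([0,t_r])$. A closed set $Z$ is $\kappa$-Morse if there is a proper function $m_Z:[1,\infty)\times[0,\infty)\to[0,\infty)$ such that every $(q,Q)$-quasi-geodesic segment with endpoints on $Z$ lies in $\mathcal N_\kappa(Z,m_Z(q,Q))$. $\partial_\kappa X$ is the set of quasi-geodesic rays from $o$ with $\kappa$-Morse image, modulo $\alpha\sim\beta\iff d(\alpha_r,\beta_r)/r\to0$, with the topology generated by the sets $\mathcal U_\kappa$ below. For hyperbolic $X$, sending the class of a geodesic ray from $o$ in $\partial_\infty X$ to its class in $\partial_\kappa X$ is a well-defined homeomorphism $\partial_\infty X\cong\partial_\kappa X$, used to identify the two. Fellow-traveling radius. Fix $H(\delta,q,Q)$, depending only on $\delta,q,Q$ (Morse lemma), such that every $(q,Q)$-quasi-geodesic segment with endpoints on a geodesic lies in the $H$-neighborhood of it, and every $(q,Q)$-quasi-geodesic ray from $o$ lies in the $H$-neighborhood of any geodesic ray from $o$ representing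 the same boundary point. Put $M(q,Q)=\max\{q,Q,H(\delta,3q,3Q),3H(\delta,q,Q)+30\delta\}$. For a geodesic ray $\alpha_0$ from $o$ and $r>0$, $\mathcal U_\kappa(\alpha_0,r)$ is the set of boundary points $b$ such that every $(q,Q)$-quasi-geodesic ray $\beta\in b$ with $M(q,Q)<\frac{r}{24\kappa(r)}$ satisfies $\beta|_r\subseteq\mathcal N_\kappa(\alpha_0,M(q,Q))$. Fix for each boundary point a geodesic representative from $o$. For distinct $a,b$ with representatives $\alpha_0,\beta_0$, $r_o(a,b)=\min\{\sup\{r>0:a\in\mathcal U_\kappa(\beta_0,r)\},\ \sup\{r>0:b\in\mathcal U_\kappa(\alpha_0,r)\}\}$ with $\sup\emptyset=0$; $r_o(a,a)=\infty$. Logarithmic metrics (base $2$). Let $\rho(a,a)=0$; for $a\ne b$ let $\rho(a,b)=1$ if $r_o(a,b)<2$ and $\rho(a,b)=2^{-\lfloor\log_2 r_o(a,b)\rfloor+1}$ if $r_o(a,b)\ge2$. An exponent $\theta$ is admissible if $0<\theta\le 1/6$. A logarithmic metric $d_{\log}=d^{X,\kappa}_{o,\theta}$ is a metric on $\partial_\kappa X$ with $d_{\log}\asymp\rho^\theta$ (equivalently $d_{\log}\asymp(1+r_o)^{-\theta}$); such metrics exist for admissible $\theta$ and induce the topology of $\partial_\kappa X$. *)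

(* Defs.v *)
From HB Require Import structures.
From mathcomp Require Import all_boot all_order all_algebra.
From mathcomp Require Import all_classical all_reals all_analysis.

Set Implicit Arguments.
Unset Strict Implicit.
Unset Printing Implicit Defensive.

Import Order.TTheory GRing.Theory Num.Theory.
Import numFieldNormedType.Exports.

Local Open Scope classical_set_scope.
Local Open Scope ring_scope.

Section MetricGeometry.
Context {R : realType} {X : metricType R}.
Implicit Types (o p x y z : X) (Z A B : set X) (I : set R).
Implicit Types (alpha beta gamma : R -> X) (q Q r s t : R).

Definition dist_to x Z : R := inf [set mdist x z | z in Z].

Definition finite_hausdorff A B : Prop :=
  exists D : R, (forall x, A x -> dist_to x B <= D) /\
                (forall y, B y -> dist_to y A <= D).

(* A map from an interval I to X is a total function R -> X of which only the
   restriction to I matters. *)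
Definition geodesic_on I gamma : Prop :=
  forall s t, I s -> I t -> mdist (gamma s) (gamma t) = `|s - t|.

Definition quasi_geodesic_on q Q I beta : Prop :=
  {within I, continuous beta} /\
  forall s t, I s -> I t ->
    q^-1 * `|s - t| - Q <= mdist (beta s) (beta t) <= q * `|s - t| + Q.

Definition ray_image beta : set X := beta @` `[0, +oo[.

Definition geodesic_ray o alpha : Prop :=
  alpha 0 = o /\ geodesic_on `[0, +oo[ alpha.

Definition quasi_geodesic_ray o q Q beta : Prop :=
  beta 0 = o /\ quasi_geodesic_on q Q `[0, +oo[ beta.

Definition is_ray o beta : Prop :=
  exists q Q, [/\ 1 <= q, 0 <= Q & quasi_geodesic_ray o q Q beta].

Definition gromov_product p x y : R :=
  (mdist x p + mdist y p - mdist x y) / 2.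

(* A point of the visual boundary is the set of all rays of its class. *)
Definition visual_boundary o : set (set (R -> X)) :=
  [set a | exists2 beta, is_ray o beta &
     a = [set gamma | is_ray o gamma /\
            finite_hausdorff (ray_image beta) (ray_image gamma)]].

(* Convergence of a sequence of X to a boundary point, in Gromov's sense:
   (x_i | alpha(t))_o --> +oo as i, t --> +oo, where alpha is a geodesic ray
   of the class a. *)
Definition cvg_to_boundary o (x : nat -> X) (a : set (R -> X)) : Prop :=
  exists alpha, [/\ geodesic_ray o alpha, a alpha &
    (fun it : nat * R => gromov_product o (x it.1) (alpha it.2))
      @ filter_prod \oo +oo --> +oo].

Definition boundary_product o (a b : set (R -> X)) : \bar R :=
  if `[< a = b >] then +oo%E
  else ereal_sup [set g | exists x y : nat -> X,
    [/\ cvg_to_boundary o x a, cvg_to_boundary o y b &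
        g = limf_einf (fun ij : nat * nat =>
              (gromov_product o (x ij.1) (y ij.2))%:E) (filter_prod \oo \oo)]].

Definition nbhd_kappa o (kappa : R -> R) Z (n : R) : set X :=
  [set x | dist_to x Z <= n * kappa (mdist o x)].

(* The set of times t >= 0 with d(o, beta(t)) = r is closed, and nonempty when
   beta is a quasi-geodesic ray from o and r >= 0: the infimum is a minimum. *)
Definition hit_time o beta r : R :=
  inf [set t | 0 <= t /\ mdist o (beta t) = r].

Definition hit_point o beta r : X := beta (hit_time o beta r).

Definition initial_part o beta r : set X := beta @` `[0, hit_time o beta r].

(* Properness of a gauge m : [1, oo) x [0, oo) -> [0, oo), which need not be
   continuous: preimages of bounded sets are bounded. *)
Definition proper_gauge (m : R -> R -> R) : Prop :=
  (forall q Q, 1 <= q -> 0 <= Q -> 0 <= m q Q) /\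
  forall N : R, exists B : R,
    forall q Q, 1 <= q -> 0 <= Q -> m q Q <= N -> q <= B /\ Q <= B.

Definition kappa_morse o (kappa : R -> R) Z : Prop :=
  closed Z /\
  exists2 m, proper_gauge m &
    forall q Q s t beta, 1 <= q -> 0 <= Q -> s <= t ->
      quasi_geodesic_on q Q `[s, t] beta -> Z (beta s) -> Z (beta t) ->
      beta @` `[s, t] `<=` nbhd_kappa o kappa Z (m q Q).

Definition morse_ray o (kappa : R -> R) beta : Prop :=
  is_ray o beta /\ kappa_morse o kappa (ray_image beta).

Definition sublinearly_close o alpha beta : Prop :=
  (fun r => mdist (hit_point o alpha r) (hit_point o beta r) / r) @ +oo --> 0.

(* As for the visual boundary, points are full equivalence classes. *)
Definition kappa_boundary o (kappa : R -> R) : set (set (R -> X)) :=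
  [set a | exists2 beta, morse_ray o kappa beta &
     a = [set gamma | morse_ray o kappa gamma /\
                      sublinearly_close o beta gamma]].

(* Graph of the identification of the visual boundary with the kappa-boundary:
   the class of a geodesic ray is sent to the class of the same ray. *)
Definition identified o (kappa : R -> R) (a a' : set (R -> X)) : Prop :=
  [/\ visual_boundary o a, kappa_boundary o kappa a' &
      exists alpha, [/\ geodesic_ray o alpha, a alpha & a' alpha]].

Definition morse_bound o (h : R -> R -> R) : Prop :=
  (forall q Q I gamma s t beta, 1 <= q -> 0 <= Q -> s <= t ->
     is_interval I -> geodesic_on I gamma ->
     quasi_geodesic_on q Q `[s, t] beta ->
     (gamma @` I) (beta s) -> (gamma @` I) (beta t) ->
     forall u, s <= u <= t -> dist_to (beta u) (gamma @` I) <= h q Q) /\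
  (forall q Q alpha beta, 1 <= q -> 0 <= Q ->
     geodesic_ray o alpha -> quasi_geodesic_ray o q Q beta ->
     finite_hausdorff (ray_image alpha) (ray_image beta) ->
     forall u, 0 <= u -> dist_to (beta u) (ray_image alpha) <= h q Q).

Definition morse_const (delta : R) (H : R -> R -> R -> R) q Q : R :=
  Num.max (Num.max q Q)
    (Num.max (H delta (3 * q) (3 * Q)) (3 * H delta q Q + 30 * delta)).

Definition fellow_set o (kappa : R -> R) (M : R -> R -> R) (alpha0 : R -> X) r
    : set (set (R -> X)) :=
  [set b | kappa_boundary o kappa b /\
     forall q Q beta, 1 <= q -> 0 <= Q ->
       b beta -> quasi_geodesic_ray o q Q beta ->
       M q Q < r / (24 * kappa r) ->
       initial_part o beta r `<=`
         nbhd_kappa o kappa (ray_image alpha0) (M q Q)].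

(* sup {r > 0 : b in U(alpha0, r)}, with sup of the empty set equal to 0. *)
Definition fellow_sup o (kappa : R -> R) (M : R -> R -> R) (alpha0 : R -> X)
    (b : set (R -> X)) : \bar R :=
  Order.max 0%E
    (ereal_sup [set r%:E | r in [set r | 0 < r /\
                                         fellow_set o kappa M alpha0 r b]]).

Definition geodesic_representatives o (kappa : R -> R)
    (rep : set (R -> X) -> R -> X) : Prop :=
  forall a, kappa_boundary o kappa a -> geodesic_ray o (rep a) /\ a (rep a).

Definition fellow_radius o (kappa : R -> R) (M : R -> R -> R)
    (rep : set (R -> X) -> R -> X) (a b : set (R -> X)) : \bar R :=
  if `[< a = b >] then +oo%E
  else Order.min (fellow_sup o kappa M (rep b) a)
                 (fellow_sup o kappa M (rep a) b).

End MetricGeometry.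

Definition proper_space {R : realType} (X : metricType R) : Prop :=
  forall (x : X) (r : R), compact [set y | mdist x y <= r].

Definition geodesic_space {R : realType} (X : metricType R) : Prop :=
  forall x y : X, exists gamma : R -> X,
    [/\ gamma 0 = x, gamma (mdist x y) = y &
        geodesic_on `[0, mdist x y] gamma].

Definition hyperbolic {R : realType} (X : metricType R) (delta : R) : Prop :=
  forall p x y z : X,
    Num.min (gromov_product p x y) (gromov_product p y z) - delta
      <= gromov_product p x z.

Definition sublinear {R : realType} (kappa : R -> R) : Prop :=
  [/\ (forall r, 0 <= r -> 1 <= kappa r),
      (forall r s, 0 <= r -> r <= s -> kappa r <= kappa s),
      (forall r s t, 0 <= r -> 0 <= s -> 0 <= t <= 1 ->
         t * kappa r + (1 - t) * kappa s <= kappa (t * r + (1 - t) * s)) &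
      (fun r => kappa r / r) @ +oo --> 0].

(* A / c <= B <= c A in the extended reals; the constant c is quantified
   explicitly wherever two quantities are compared. *)
Definition comparable_by {R : realType} (c : R) (A B : \bar R) : Prop :=
  ((c^-1)%:E * B <= A)%E /\ (A <= c%:E * B)%E.

(* ro plays the role of the fellow-traveling radius, which is finite at
   distinct points. *)
Definition log_scale {R : realType} {T : Type} (ro : T -> T -> \bar R)
    (a b : T) : R :=
  if `[< a = b >] then 0
  else if (ro a b < 2%:E)%E then 1
  else 2 ^ (- Num.floor (ln (fine (ro a b)) / ln 2) + 1).

Definition is_metric_on {R : realType} {T : Type} (S : set T) (d : T -> T -> R)
    : Prop :=
  [/\ (forall a b, S a -> S b -> 0 <= d a b),
      (forall a b, S a -> S b -> d a b = 0 <-> a = b),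
      (forall a b, S a -> S b -> d a b = d b a) &
      (forall a b c, S a -> S b -> S c -> d a c <= d a b + d b c)].

Definition admissible {R : realType} (theta : R) : Prop :=
  0 < theta <= 1 / 6.

Definition log_metric {R : realType} {T : Type} (S : set T)
    (ro : T -> T -> \bar R) (theta : R) (d : T -> T -> R) : Prop :=
  is_metric_on S d /\
  exists2 c : R, 1 <= c & forall a b, S a -> S b ->
    comparable_by c (d a b)%:E (log_scale ro a b `^ theta)%:E.

(* Main.v *)
Require Import Defs.
From HB Require Import structures.
From mathcomp Require Import all_boot all_order all_algebra.
From mathcomp Require Import all_classical all_reals all_analysis.
From mathcomp Require Import ring lra.

Set Implicit Arguments.
Unset Strict Implicit.
Unset Printing Implicit Defensive.

Import Order.TTheory GRing.Theory Num.Theory.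
Import numFieldNormedType.Exports.

Local Open Scope classical_set_scope.
Local Open Scope ring_scope.

(* Let alpha, beta be geodesic rays representing a, b, and g = (a | b)_o.  For
   r < g, hyperbolicity gives (alpha t | beta t)_o >= r - 2 delta for large t,
   so alpha and beta stay 8 delta-close up to time r; a quasi-geodesic in the
   class of b stays H + 4 delta close to beta, hence within 2 H + 16 delta of
   alpha as long as it is in the ball of radius r, and M >= 3 H + 30 delta.
   Conversely, if b is in U_kappa(alpha, r), either r is bounded because kappa
   is sublinear, or beta itself may be tested at time r, which gives
   g >= r - M(1, 0) kappa(r) with M(1, 0) kappa(r) < r / 24; then r <= 2 g and
   kappa(r) <= 2 kappa(g) by concavity. *)

Section Rays.
Context {R : realType} {X : metricType R}.
Implicit Types (o p x y z : X) (A B Z : set X) (alpha beta gamma : R -> X).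
Implicit Types (q Q r s t u m D e : R).

Lemma dist_to_le x Z z : Z z -> dist_to x Z <= mdist x z.
Proof.
move=> Zz; apply: ge_inf; last by exists z.
by exists 0 => _ [y _ <-]; exact: mdist_ge0.
Qed.

Lemma dist_to_near x Z D e : Z !=set0 -> dist_to x Z <= D -> 0 < e ->
  exists2 z, Z z & mdist x z < D + e.
Proof.
move=> [z0 Zz0] xZ e0.
have [|_ [z Zz <-] lt_e] := @inf_adherent _ [set mdist x z | z in Z] _ e0.
  by split; [exists (mdist x z0), z0 | exists 0 => _ [y _ <-]; exact: mdist_ge0].
by exists z => //; apply: lt_le_trans lt_e _; rewrite lerD2r.
Qed.

Lemma mdist_normB o x y : `|mdist o x - mdist o y| <= mdist x y.
Proof.
have h1 := metric_triangle o y x; have h2 := metric_triangle o x y.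
by rewrite (metric_sym y x) in h1; rewrite ler_norml; apply/andP; split; lra.
Qed.

Lemma mdist_continuous o : continuous (mdist o : X -> R).
Proof.
move=> x; apply/cvgrPdist_lt => e e0.
have : nbhs x (ball x e) by exact: nbhsx_ballx.
apply: filterS => y; rewrite ballEmdist /= => xy.
exact: le_lt_trans (mdist_normB o x y) xy.
Qed.

Lemma gromov_productC p x y : gromov_product p x y = gromov_product p y x.
Proof. by rewrite /gromov_product (metric_sym x y) (addrC (mdist x p)). Qed.

Lemma gromov_product_ge0 p x y : 0 <= gromov_product p x y.
Proof.
by rewrite divr_ge0// subr_ge0 (metric_sym y) metric_triangle.
Qed.

Lemma gromov_product_ler p x y z :
  gromov_product p x y - mdist y z <= gromov_product p x z.
Proof.
have h1 := metric_triangle y z p; have h2 := metric_triangle x y z.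
by rewrite /gromov_product; lra.
Qed.

Lemma geodesic_rayE o alpha s t : geodesic_ray o alpha -> 0 <= s -> 0 <= t ->
  mdist (alpha s) (alpha t) = `|s - t|.
Proof. by move=> [_ ag] s0 t0; apply: ag; rewrite /= in_itv/= andbT. Qed.

Lemma geodesic_ray_norm o alpha s : geodesic_ray o alpha -> 0 <= s ->
  mdist o (alpha s) = s.
Proof.
move=> ag s0; have [<- _] := ag.
by rewrite (geodesic_rayE ag)// sub0r normrN ger0_norm.
Qed.

Lemma gromov_product_geodesic p x y : mdist p y = mdist p x + mdist x y ->
  gromov_product p x y = mdist p x.
Proof.
by move=> h; rewrite /gromov_product !(metric_sym _ p) h; field.
Qed.

Lemma gromov_product_ray o alpha s t : geodesic_ray o alpha ->
  0 <= s -> s <= t -> gromov_product o (alpha s) (alpha t) = s.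
Proof.
move=> ag s0 st; have t0 := le_trans s0 st.
rewrite gromov_product_geodesic !(geodesic_ray_norm ag)// (geodesic_rayE ag)//.
by rewrite distrC ger0_norm ?subr_ge0// addrC subrK.
Qed.

Lemma hit_time_ray o alpha r : geodesic_ray o alpha -> 0 <= r ->
  hit_time o alpha r = r.
Proof.
move=> ag r0; rewrite /hit_time; suff -> : [set t | 0 <= t /\
  mdist o (alpha t) = r] = [set r] by rewrite inf1.
apply/seteqP; split=> [t [t0]|t ->] /=; first by rewrite (geodesic_ray_norm ag).
by rewrite (geodesic_ray_norm ag).
Qed.

Lemma hit_time_ge0 o beta r : 0 <= hit_time o beta r.
Proof.
rewrite /hit_time; set S := [set t | _].
have [->|S0] := eqVneq S set0; first by rewrite inf0.
by apply: lb_le_inf; [exact/set0P | move=> t []].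
Qed.

Lemma initial_part_norm o q Q beta r x : quasi_geodesic_ray o q Q beta ->
  0 <= r -> initial_part o beta r x -> mdist o x <= r.
Proof.
move=> [b0 [bc _]] r0 [s /=]; rewrite in_itv/= => /andP[s0 sT] <-.
rewrite leNgt; apply/negP => rs.
have cont : {within `[0, s], continuous (fun t => mdist o (beta t))}.
  have bs : {within `[0, s], continuous beta}.
    apply: continuous_subspaceW bc => t /=; rewrite !in_itv/= => /andP[-> _] //.
  by move=> t; apply: continuous_comp; [exact: bs | exact: mdist_continuous].
have [|c cs cr] := @IVT _ _ _ _ r s0 cont.
  by rewrite b0 mdistxx ge_min r0/= le_max (ltW rs) orbT.
move: cs; rewrite in_itv/= => /andP[c0 cs].
have Tc : hit_time o beta r <= c.
  by apply: ge_inf; [exists 0 => t [] | split].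
have sc : s = c by apply/eqP; rewrite eq_le cs (le_trans sT Tc).
by rewrite -cr sc ltxx in rs.
Qed.

Lemma quasi_geodesic_onS q Q (I J : set R) beta : J `<=` I ->
  quasi_geodesic_on q Q I beta -> quasi_geodesic_on q Q J beta.
Proof.
move=> JI [bc bI]; split; first exact: continuous_subspaceW bc.
by move=> s t Js Jt; apply: bI; exact: JI.
Qed.

Lemma finite_hausdorff_trans A B Z : A !=set0 -> B !=set0 -> Z !=set0 ->
  finite_hausdorff A B -> finite_hausdorff B Z -> finite_hausdorff A Z.
Proof.
move=> A0 B0 Z0 [D [AB BA]] [E [BZ ZB]]; exists (D + E + 2); split=> x xP.
- have [y By xy] := dist_to_near B0 (AB _ xP) ltr01.
  have [z Zz yz] := dist_to_near Z0 (BZ _ By) ltr01.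
  apply: le_trans (dist_to_le x Zz) _.
  by have h := metric_triangle x y z; lra.
- have [y By xy] := dist_to_near B0 (ZB _ xP) ltr01.
  have [z Az yz] := dist_to_near A0 (BA _ By) ltr01.
  apply: le_trans (dist_to_le x Az) _.
  by have h := metric_triangle x y z; lra.
Qed.

Lemma finite_hausdorff_sym A B : finite_hausdorff A B -> finite_hausdorff B A.
Proof. by move=> [D [h1 h2]]; exists D. Qed.

Lemma ray_image_neq0 beta : ray_image beta !=set0.
Proof. by exists (beta 0), 0; rewrite //= in_itv/= lexx. Qed.

Lemma finite_hausdorff_rays alpha beta D :
  (forall u, 0 <= u -> mdist (alpha u) (beta u) <= D) ->
  finite_hausdorff (ray_image alpha) (ray_image beta).
Proof.
move=> h; exists D; split=> _ [u /= u0 <-]; have u0' := u0;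
  rewrite in_itv/= andbT in u0'.
- by apply: le_trans (h _ u0'); apply: dist_to_le; exists u.
- by apply: le_trans (h _ u0'); rewrite metric_sym; apply: dist_to_le; exists u.
Qed.

Lemma visual_boundary_hausdorff o (a : set (R -> X)) alpha beta :
  visual_boundary o a -> a alpha -> a beta ->
  finite_hausdorff (ray_image alpha) (ray_image beta).
Proof.
move=> [g gr ->] [_ ga] [_ gb].
by apply: finite_hausdorff_trans gb; [..| exact: finite_hausdorff_sym];
  exact: ray_image_neq0.
Qed.

Lemma visual_boundary_mem o (a : set (R -> X)) alpha beta :
  visual_boundary o a -> a alpha -> is_ray o beta ->
  finite_hausdorff (ray_image alpha) (ray_image beta) -> a beta.
Proof.
move=> [g gr ->] [_ ga] br ab; split=> //.
by apply: finite_hausdorff_trans ab => //; exact: ray_image_neq0.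
Qed.

Lemma visual_boundary_eq o (a b : set (R -> X)) alpha beta :
  visual_boundary o a -> visual_boundary o b -> a alpha -> b beta ->
  finite_hausdorff (ray_image alpha) (ray_image beta) -> a = b.
Proof.
move=> va vb aa bb ab; apply/seteqP; split=> gamma gP.
- have [g _ ag] := va; have gr : is_ray o gamma by move: gP; rewrite ag => -[].
  apply: (visual_boundary_mem vb bb gr).
  apply: finite_hausdorff_trans (visual_boundary_hausdorff va aa gP);
    [exact: ray_image_neq0..|exact: finite_hausdorff_sym].
- have [g _ bg] := vb; have gr : is_ray o gamma by move: gP; rewrite bg => -[].
  apply: (visual_boundary_mem va aa gr).
  apply: finite_hausdorff_trans (visual_boundary_hausdorff vb bb gP) => //;
    exact: ray_image_neq0.
Qed.

Lemma sublinearly_close_large o alpha beta gamma e N :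
  sublinearly_close o gamma alpha -> sublinearly_close o gamma beta -> 0 < e ->
  exists2 r, N <= r &
    mdist (hit_point o alpha r) (hit_point o beta r) <= e * r.
Proof.
move=> ca cb e0; have e20 : 0 < e / 2 by rewrite divr_gt0.
have na : \forall r \near +oo, `|mdist (hit_point o gamma r)
    (hit_point o alpha r) / r| < e / 2 by exact: cvgr0_norm_lt ca _ e20.
have nb : \forall r \near +oo, `|mdist (hit_point o gamma r)
    (hit_point o beta r) / r| < e / 2 by exact: cvgr0_norm_lt cb _ e20.
have np := nbhs_pinfty_gt (num_real (Num.max 0 N)).
have [r [[ra rb] rN]] := filter_ex (filterI (filterI na nb) np).
move: rN; rewrite /= gt_max => /andP[r0 Nr]; exists r; first exact: ltW.
move: ra rb; rewrite /= !normrM !normfV !(ger0_norm (mdist_ge0 _ _)).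
rewrite (gtr0_norm r0) !ltr_pdivrMr// (metric_sym _ (hit_point o alpha r)).
have := metric_triangle (hit_point o alpha r) (hit_point o gamma r)
  (hit_point o beta r).
lra.
Qed.

Lemma kappa_boundary_close o kappa (a : set (R -> X)) alpha beta e N :
  kappa_boundary o kappa a -> a alpha -> a beta -> 0 < e ->
  exists2 r, N <= r &
    mdist (hit_point o alpha r) (hit_point o beta r) <= e * r.
Proof.
by move=> [g _ ->] [_ ga] [_ gb]; exact: sublinearly_close_large ga gb.
Qed.

Lemma kappa_boundary_ray o kappa (a : set (R -> X)) beta :
  kappa_boundary o kappa a -> a beta -> is_ray o beta.
Proof. by move=> [g _ ->] [[]]. Qed.

Lemma geodesic_quasi_geodesic o beta : is_ray o beta -> geodesic_ray o beta ->
  quasi_geodesic_ray o 1 0 beta.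
Proof.
move=> [q [Q [_ _ [b0 [bc _]]]]] [_ bg]; split=> //; split=> // s t s0 t0.
by rewrite bg// invr1 !mul1r subr0 addr0 lexx.
Qed.

End Rays.

Section Hyperbolic.
Context {R : realType} {X : metricType R} (delta : R).
Context (delta_ge0 : 0 <= delta) (X_hyp : hyperbolic X delta).
Implicit Types (o p x y z : X) (alpha beta gamma : R -> X).
Implicit Types (q Q r s t u m D e : R).

Lemma gromov_product_chain p x y x' y' m :
  m <= gromov_product p x x' -> m <= gromov_product p x' y' ->
  m <= gromov_product p y' y -> m - 2 * delta <= gromov_product p x y.
Proof.
move=> h1 h2 h3; have H1 := X_hyp p x x' y'; have H2 := X_hyp p x y' y.
have : m - delta <= gromov_product p x y'.
  by apply: le_trans H1; rewrite lerD2r le_min h1.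
move=> h4; apply: le_trans H2.
rewrite (_ : m - 2 * delta = m - delta - delta); last by ring.
by rewrite lerD2r le_min h4/= (le_trans _ h3)// lerBlDr lerDl.
Qed.

Lemma fellow_travel p x y x' y' u e : mdist p x = u -> mdist p y = u ->
  u - e <= gromov_product p x x' -> u - e <= gromov_product p x' y' ->
  u - e <= gromov_product p y' y -> mdist x y <= 2 * e + 4 * delta.
Proof.
move=> xu yu h1 h2 h3; have := gromov_product_chain h1 h2 h3.
by rewrite /gromov_product !(metric_sym _ p) xu yu; lra.
Qed.

Lemma fellow_travel_rays o alpha beta s t u e :
  geodesic_ray o alpha -> geodesic_ray o beta -> 0 <= e ->
  0 <= u -> u <= s -> u <= t ->
  u - e <= gromov_product o (alpha s) (beta t) ->
  mdist (alpha u) (beta u) <= 2 * e + 4 * delta.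
Proof.
move=> ag bg e0 u0 us ut h; apply: fellow_travel h _ => //.
- exact: geodesic_ray_norm ag _.
- exact: geodesic_ray_norm bg _.
- by rewrite (gromov_product_ray ag)//; lra.
- by rewrite gromov_productC (gromov_product_ray bg)//; lra.
Qed.

Lemma close_rays o alpha beta u :
  geodesic_ray o alpha -> geodesic_ray o beta ->
  (forall N, exists2 t, N <= t & mdist (alpha t) (beta t) <= t) ->
  0 <= u -> mdist (alpha u) (beta u) <= 4 * delta.
Proof.
move=> ag bg close u0; have [t ut abt] := close (2 * u).
have tu : u <= t by lra.
have t0 := le_trans u0 tu.
have := @fellow_travel_rays o alpha beta t t u 0 ag bg (lexx _) u0 tu tu.
rewrite mulr0 add0r; apply; rewrite /gromov_product !(metric_sym _ o).
by rewrite (geodesic_ray_norm ag)// (geodesic_ray_norm bg)//; lra.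
Qed.

Lemma hausdorff_rays o alpha beta u :
  geodesic_ray o alpha -> geodesic_ray o beta ->
  finite_hausdorff (ray_image alpha) (ray_image beta) ->
  0 <= u -> mdist (alpha u) (beta u) <= 4 * delta.
Proof.
move=> ag bg [D [ab _]]; apply: (close_rays ag bg) => // N.
pose t := Num.max N (Num.max 0 (2 * (D + 1))).
have tN : N <= t by rewrite le_max lexx.
have t0 : 0 <= t by rewrite !le_max lexx orbT.
have tD : 2 * (D + 1) <= t by rewrite !le_max lexx !orbT.
have dD : dist_to (alpha t) (ray_image beta) <= D.
  by apply: ab; exists t; rewrite //= in_itv/= t0.
have [_ [v /= v0 <-] avt] := dist_to_near (ray_image_neq0 _) dD ltr01.
exists t => //.
rewrite in_itv/= andbT in v0.
have := mdist_normB o (alpha t) (beta v).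
rewrite (geodesic_ray_norm ag)// (geodesic_ray_norm bg)// distrC.
rewrite -(geodesic_rayE bg)//.
by have := metric_triangle (alpha t) (beta v) (beta t); lra.
Qed.

Lemma kappa_boundary_rays o kappa (a : set (R -> X)) alpha beta u :
  geodesic_ray o alpha -> geodesic_ray o beta ->
  kappa_boundary o kappa a -> a alpha -> a beta ->
  0 <= u -> mdist (alpha u) (beta u) <= 4 * delta.
Proof.
move=> ag bg ka aa ab; apply: (close_rays ag bg) => // N.
have [r] := kappa_boundary_close (Num.max 0 N) ka aa ab ltr01.
rewrite ge_max mul1r => /andP[r0 Nr]; rewrite /hit_point.
by rewrite (hit_time_ray ag)// (hit_time_ray bg)//; exists r.
Qed.

(* The quasi-geodesic up to a far hitting point lies near the segment [o, y],
   and that segment fellow travels with the geodesic ray. *)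
Lemma kappa_boundary_quasi_geodesic o kappa (a : set (R -> X)) (h : R -> R -> R)
    alpha q Q beta s e :
  geodesic_space X -> morse_bound o h -> kappa_boundary o kappa a ->
  geodesic_ray o alpha -> a alpha -> 1 <= q -> 0 <= Q ->
  quasi_geodesic_ray o q Q beta -> a beta -> 0 <= s -> 0 < e ->
  exists2 u, 0 <= u & mdist (beta s) (alpha u) <= h q Q + 4 * delta + e.
Proof.
move=> Xg [hm _] ka ag aa q1 Q0 bq ba s0 e0.
have [b0 bqo] := bq; set ns := mdist o (beta s).
pose N := Num.max 1 (Num.max (2 * (ns + h q Q + e)) (2 * (q * s + Q))).
have e40 : (0 : R) < 1 / 4 by lra.
have [r] := kappa_boundary_close N ka aa ba e40.
rewrite /N !ge_max => /and3P[r1 rn rs]; have r0 := le_trans ler01 r1.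
rewrite /hit_point (hit_time_ray ag)//.
set T := hit_time o beta r; set y := beta T => yr.
have T0 : 0 <= T by exact: hit_time_ge0.
have yn := mdist_normB o (alpha r) y; rewrite (geodesic_ray_norm ag)// in yn.
have {yn}yn : r - mdist o y <= mdist (alpha r) y.
  by apply: le_trans yn; exact: ler_norm.
have i0 : `[0, +oo[%classic (0 : R) by rewrite /= in_itv/= lexx.
have iT : `[0, +oo[%classic T by rewrite /= in_itv/= T0.
have sT : s <= T.
  have := (bqo.2 0 T i0 iT); rewrite b0 sub0r normrN (ger0_norm T0) -/y.
  move=> /andP[_ h1]; rewrite leNgt; apply/negP => Ts.
  have : q * T <= q * s by rewrite ler_wpM2l ?(ltW Ts)//; lra.
  by have := mulr_ge0 (le_trans ler01 q1) s0; lra.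
have [gamma [g0 gn gg]] := Xg o y; set n := mdist o y in gn gg.
have n0 : 0 <= n by exact: mdist_ge0.
have bT : quasi_geodesic_on q Q `[0, T] beta.
  apply: quasi_geodesic_onS bqo => t /=.
  by rewrite !in_itv/= => /andP[-> _].
have j0 : `[0, n]%classic (0 : R) by rewrite /= in_itv/= lexx n0.
have jn : `[0, n]%classic n by rewrite /= in_itv/= lexx n0.
have := hm q Q `[0, n]%classic gamma 0 T beta q1 Q0 T0
  (@interval_is_interval _ _) gg bT.
have -> : beta 0 = gamma 0 by rewrite b0.
have -> : beta T = gamma n by rewrite gn.
have m0 : (gamma @` `[0, n]) (gamma 0) by exists 0.
have mn : (gamma @` `[0, n]) (gamma n) by exists n.
move=> /(_ m0 mn s); rewrite s0 sT => /(_ isT) ds.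
have [|_ [u uP <-] su] := dist_to_near _ ds e0; first by exists (gamma 0).
have := uP; rewrite /= in_itv/= => /andP[u0 un].
have gu : mdist o (gamma u) = u.
  by rewrite -g0 gg// sub0r normrN ger0_norm.
exists u => //.
have ur : u <= r / 2.
  have := mdist_normB o (gamma u) (beta s); rewrite gu => /(le_trans (ler_norm _)).
  by rewrite (metric_sym (gamma u)) -/ns; lra.
have ur' : u <= r by lra.
suff : mdist (gamma u) (alpha u) <= 4 * delta.
  by have := metric_triangle (beta s) (gamma u) (alpha u); lra.
have -> : 4 * delta = 2 * 0 + 4 * delta by rewrite mulr0 add0r.
apply: (@fellow_travel o _ _ y (alpha r) u 0) => //.
- exact: geodesic_ray_norm ag _.
- have gy : mdist (gamma u) y = n - u.
    by rewrite -gn gg// distrC ger0_norm// subr_ge0.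
  by rewrite subr0 gromov_product_geodesic ?gu// gy -/n; lra.
- rewrite /gromov_product !(metric_sym _ o) (geodesic_ray_norm ag)//.
  by rewrite (metric_sym y); lra.
- by rewrite gromov_productC (gromov_product_ray ag)//; lra.
Qed.

End Hyperbolic.

Section BoundaryProduct.
Context {R : realType} {X : metricType R} (o : X).
Implicit Types (x y z : X) (alpha beta gamma : R -> X) (a b : set (R -> X)).
Implicit Types (r s t u v N : R).

Lemma gromov_product_ray_ge alpha s t v : geodesic_ray o alpha ->
  0 <= s -> 0 <= t -> v <= s -> v <= t ->
  v <= gromov_product o (alpha s) (alpha t).
Proof.
move=> ag s0 t0 vs vt; have [st|ts] := leP s t.
  by rewrite (gromov_product_ray ag).
by rewrite gromov_productC (gromov_product_ray ag)// ltW.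
Qed.

Lemma gromov_product_rays_mono alpha beta s t r :
  geodesic_ray o alpha -> geodesic_ray o beta -> 0 <= r -> r <= s -> r <= t ->
  gromov_product o (alpha r) (beta r) <= gromov_product o (alpha s) (beta t).
Proof.
move=> ag bg r0 rs rt; have s0 := le_trans r0 rs; have t0 := le_trans r0 rt.
have h1 := metric_triangle (alpha s) (alpha r) (beta t).
have h2 := metric_triangle (alpha r) (beta r) (beta t).
move: h1 h2; rewrite (geodesic_rayE ag)// (geodesic_rayE bg)//.
rewrite ger0_norm ?subr_ge0// ler0_norm ?subr_le0// /gromov_product.
by rewrite !(metric_sym _ o) !(geodesic_ray_norm ag)// !(geodesic_ray_norm bg)//;
  lra.
Qed.

Lemma cvg_to_boundary_ray a alpha : geodesic_ray o alpha -> a alpha ->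
  cvg_to_boundary o (fun i => alpha i%:R) a.
Proof.
move=> ag aa; exists alpha; split=> //; apply/cvgryPge => A.
exists ([set i | A <= i%:R], [set t | Num.max 0 A <= t]) => /=.
  by split; [exact: nbhs_infty_ger | exact/nbhs_pinfty_ge/num_real].
move=> [i t] [/= Ai]; rewrite ge_max => /andP[t0 At].
exact: gromov_product_ray_ge.
Qed.

Lemma boundary_product_ge a b alpha beta N v : a <> b ->
  geodesic_ray o alpha -> a alpha -> geodesic_ray o beta -> b beta ->
  (forall s t, 0 <= s -> 0 <= t -> N <= s -> N <= t ->
    v <= gromov_product o (alpha s) (beta t)) ->
  (v%:E <= boundary_product o a b)%E.
Proof.
move=> ab ag aa bg bb h; rewrite /boundary_product; case: asboolP => // _.
set x := fun i : nat => alpha i%:R; set y := fun j : nat => beta j%:R.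
apply: (@le_trans _ _ (limf_einf (fun ij : nat * nat =>
    (gromov_product o (x ij.1) (y ij.2))%:E) (filter_prod \oo \oo))); last first.
  apply: ereal_sup_ubound; exists x, y.
  by split=> //; exact: cvg_to_boundary_ray.
rewrite limf_einfE; set V := [set i : nat | N <= i%:R] `*` [set i | N <= i%:R].
apply: (@le_trans _ _ (ereal_inf ((fun ij : nat * nat =>
    (gromov_product o (x ij.1) (y ij.2))%:E) @` V))); last first.
  apply: ereal_sup_ubound; exists V => //.
  by exists ([set i | N <= i%:R], [set i | N <= i%:R]) => //;
    split; exact: nbhs_infty_ger.
by apply: le_ereal_inf_tmp => _ [[i j] /= [Ni Nj] <-]; rewrite lee_fin; exact: h.
Qed.

Lemma boundary_product_lt (delta : R) a b alpha beta r :
  0 <= delta -> hyperbolic X delta -> a <> b ->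
  visual_boundary o a -> visual_boundary o b ->
  geodesic_ray o alpha -> a alpha -> geodesic_ray o beta -> b beta ->
  (r%:E < boundary_product o a b)%E ->
  exists N, forall s t, 0 <= s -> 0 <= t -> N <= s -> N <= t ->
    r - 2 * delta <= gromov_product o (alpha s) (beta t).
Proof.
move=> d0 Xh ab va vb ag aa bg bb; rewrite /boundary_product.
case: asboolP => // _ /ereal_sup_gt[_ [x [y [xa yb ->]]]].
rewrite limf_einfE => /ereal_sup_gt[_ [V [[P Q] /= [oP oQ] PQV] <-]] rV.
have cvgP (z : nat -> X) c gamma : visual_boundary o c -> geodesic_ray o gamma ->
    c gamma -> cvg_to_boundary o z c -> exists2 S : set nat, \oo S & exists N,
    forall i s, S i -> 0 <= s -> N <= s -> r <= gromov_product o (z i) (gamma s).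
  move=> vc gg cg [g1 [g1g cg1 /cvgryPge/(_ (r + 4 * delta))]].
  move=> [[S T] /= [oS [N [_ NT]]] STr].
  exists S => //; exists (N + 1) => i s Si s0 Ns.
  have := STr (i, s); rewrite /= => /(_ (conj Si _)) h.
  have {}h : r + 4 * delta <= gromov_product o (z i) (g1 s).
    by apply: h; apply: NT; lra.
  have fh := visual_boundary_hausdorff vc cg1 cg.
  have := hausdorff_rays d0 Xh g1g gg fh s0.
  by have := gromov_product_ler o (z i) (g1 s) (gamma s); lra.
have [S oS [N SN]] := cvgP _ _ _ va ag aa xa.
have [S' oS' [N' SN']] := cvgP _ _ _ vb bg bb yb.
have [i [Pi Si]] := filter_ex (filterI oP oS).
have [j [Qj Sj]] := filter_ex (filterI oQ oS').
have rij : r <= gromov_product o (x i) (y j).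
  rewrite -lee_fin; apply/ltW/(lt_le_trans rV); apply: ereal_inf_lbound.
  by exists (i, j) => //; exact: PQV.
exists (Num.max N N') => s t s0 t0; rewrite !ge_max => /andP[Ns _] /andP[_ Nt].
apply: (gromov_product_chain d0 Xh _ rij); last exact: SN'.
by rewrite gromov_productC; exact: SN.
Qed.

End BoundaryProduct.

Section Sublinear.
Context {R : realType} (kappa : R -> R) (kappa_sub : sublinear kappa).
Implicit Types (r g M : R).

Lemma sublinear_ge1 r : 0 <= r -> 1 <= kappa r.
Proof. by case: kappa_sub => + _ _ _; apply. Qed.

Lemma sublinear_le r s : 0 <= r -> r <= s -> kappa r <= kappa s.
Proof. by case: kappa_sub => _ + _ _; apply. Qed.

Lemma sublinear_double r : 0 <= r -> kappa (2 * r) <= 2 * kappa r.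
Proof.
move=> r0; have [_ _ /(_ (2 * r) 0 (1 / 2)) h _] := kappa_sub.
have k0 := sublinear_ge1 (lexx 0).
have : 1 / 2 * kappa (2 * r) + (1 - 1 / 2) * kappa 0
    <= kappa (1 / 2 * (2 * r) + (1 - 1 / 2) * 0).
  by apply: h; lra.
rewrite (_ : 1 / 2 * (2 * r) + (1 - 1 / 2) * 0 = r); last by field.
by lra.
Qed.

Lemma sublinear_linear r : 0 <= r -> kappa r <= kappa 1 * (1 + r).
Proof.
move=> r0; have k1 := sublinear_ge1 ler01.
have [r1|r1] := leP r 1.
  apply: le_trans (sublinear_le r0 r1) _.
  by rewrite ler_peMr ?lerDl//; lra.
have [_ _ /(_ r 0 r^-1) h _] := kappa_sub.
have rr : 0 < r by lra.
have ri : r^-1 * r = 1 by rewrite mulVf ?gt_eqF.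
have ri1 : r^-1 <= 1 by rewrite invf_le1// ltW.
have ri0 : 0 <= r^-1 by rewrite invr_ge0.
have := h r0 (lexx _); rewrite ri0 ri1 mulr0 addr0 ri => /(_ isT) h1.
have k0 := sublinear_ge1 (lexx 0).
have : r^-1 * kappa r <= kappa 1.
  have : 0 <= (1 - r^-1) * kappa 0 by apply: mulr_ge0; lra.
  by lra.
by rewrite mulrC ler_pdivrMr//; lra.
Qed.

Lemma sublinear_bound M : 0 < M ->
  exists2 r0, 0 <= r0 & forall r, r0 < r -> M < r / (24 * kappa r).
Proof.
move=> M0; have [_ _ _ k0] := kappa_sub.
have e0 : 0 < (24 * M)^-1 by rewrite invr_gt0 mulr_gt0.
have [N [_ hN]] : \forall r \near +oo, `|kappa r / r| < (24 * M)^-1.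
  exact: cvgr0_norm_lt k0 _ e0.
exists (Num.max 0 N); first by rewrite le_max lexx.
move=> r; rewrite gt_max => /andP[r0 Nr]; have k1 := sublinear_ge1 (ltW r0).
have := hN _ Nr; rewrite ger0_norm; last by rewrite divr_ge0//; lra.
rewrite ltr_pdivrMr// mulrC ltr_pdivlMr ?mulr_gt0// => h.
by rewrite ltr_pdivlMr; lra.
Qed.

End Sublinear.

Section FellowRadius.
Context {R : realType} {X : metricType R} (o : X) (delta : R) (kappa : R -> R).
Context (H : R -> R -> R -> R) (rep : set (R -> X) -> R -> X).
Context (X_geodesic : geodesic_space X) (delta_ge0 : 0 <= delta).
Context (X_hyperbolic : hyperbolic X delta) (kappa_sublinear : sublinear kappa).
Context (H_morse : morse_bound o (H delta)).
Context (rep_geodesic : geodesic_representatives o kappa rep).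
Implicit Types (a b : set (R -> X)) (alpha beta : R -> X) (r g N : R).

Let M := morse_const delta H.
Let ro := fellow_radius o kappa M rep.

Lemma morse_bound_ge0 q Q beta : 1 <= q -> 0 <= Q ->
  quasi_geodesic_ray o q Q beta -> 0 <= H delta q Q.
Proof.
move=> q1 Q0 [_ bq]; have i0 : `[0, 0]%classic (0 : R) by rewrite /= in_itv/= lexx.
have b0 : quasi_geodesic_on q Q `[0, 0] beta.
  by apply: quasi_geodesic_onS bq => t /=; rewrite !in_itv/= => /andP[-> _].
have g0 : geodesic_on `[0, 0] beta.
  move=> s t /=; rewrite !in_itv/= => /le_anti <- /le_anti <-.
  by rewrite mdistxx subrr normr0.
have m0 : (beta @` `[0, 0]) (beta 0) by exists 0.
have := H_morse.1 q Q _ beta 0 0 beta q1 Q0 (lexx _)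
  (@interval_is_interval _ _) g0 b0 m0 m0 0.
rewrite lexx => /(_ isT); apply: le_trans; apply: lb_le_inf.
  by exists (mdist (beta 0) (beta 0)), (beta 0).
by move=> _ [z _ <-]; exact: mdist_ge0.
Qed.

Lemma morse_const_ge q Q :
  [/\ q <= M q Q & 3 * H delta q Q + 30 * delta <= M q Q].
Proof. by rewrite /M /morse_const !le_max !lexx !orbT. Qed.

Lemma fellow_set_near alpha beta b r :
  kappa_boundary o kappa b -> geodesic_ray o alpha ->
  geodesic_ray o beta -> b beta -> 0 < r ->
  (exists N, forall s t, 0 <= s -> 0 <= t -> N <= s -> N <= t ->
    r - 2 * delta <= gromov_product o (alpha s) (beta t)) ->
  fellow_set o kappa M alpha r b.
Proof.
move=> kb ag bg bb r0 [N hN]; split=> // q Q eta q1 Q0 be eq _ x xi.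
have h0 := morse_bound_ge0 q1 Q0 eq.
have [_ hM] := morse_const_ge q Q; have d0 := delta_ge0.
have nx : mdist o x <= r := initial_part_norm eq (ltW r0) xi.
set u := mdist o x in nx *; have u0 : 0 <= u by exact: mdist_ge0.
have [s /=] := xi; rewrite in_itv/= => /andP[s0 _] sx.
have xb e : 0 < e -> mdist x (beta u) <= 2 * (H delta q Q + 4 * delta + e).
  move=> e0; have [v v0] := kappa_boundary_quasi_geodesic delta_ge0 X_hyperbolic
    X_geodesic H_morse kb bg bb q1 Q0 eq be s0 e0.
  rewrite sx => xv; have := mdist_normB o x (beta v).
  rewrite (geodesic_ray_norm bg)// distrC -/u -(geodesic_rayE bg)// => vu.
  by have := metric_triangle x (beta v) (beta u); lra.
have ab : mdist (alpha u) (beta u) <= 2 * (2 * delta) + 4 * delta.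
  pose t := Num.max r N; have rt : r <= t by rewrite le_max lexx.
  have Nt : N <= t by rewrite le_max lexx orbT.
  have t0 : 0 <= t by lra.
  apply: (fellow_travel_rays delta_ge0 X_hyperbolic ag bg (s := t) (t := t)) => //.
  - by rewrite mulr_ge0.
  - exact: le_trans nx rt.
  - exact: le_trans nx rt.
  by apply: le_trans (hN t t t0 t0 Nt Nt); lra.
have dx : dist_to x (ray_image alpha) <= M q Q.
  apply: le_trans hM; apply/ler_addgt0Pr => e e0.
  have ua : ray_image alpha (alpha u) by exists u; rewrite //= in_itv/= u0.
  apply: le_trans (dist_to_le x ua) _.
  have e20 : 0 < e / 2 by lra.
  have := xb _ e20; have := metric_triangle x (beta u) (alpha u).
  by rewrite (metric_sym (beta u)); lra.
apply: le_trans dx _; rewrite ler_peMr//; first by lra.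
exact: sublinear_ge1.
Qed.

Lemma fellow_set_product alpha beta b r :
  geodesic_ray o alpha -> geodesic_ray o beta -> is_ray o beta -> b beta ->
  0 < r -> M 1 0 < r / (24 * kappa r) -> fellow_set o kappa M alpha r b ->
  r - M 1 0 * kappa r <= gromov_product o (alpha r) (beta r).
Proof.
move=> ag bg br bb r0 Mr [_ fb]; have r0' := ltW r0.
have ib : initial_part o beta r (beta r).
  by exists r => //=; rewrite (hit_time_ray bg)// in_itv/= r0' lexx.
have := fb 1 0 beta (lexx _) (lexx _) bb (geodesic_quasi_geodesic br bg) Mr _ ib.
rewrite /nbhd_kappa /= (geodesic_ray_norm bg)// => dr.
apply/ler_addgt0Pr => e e0.
have [_ [v /= v0 <-] bv] := dist_to_near (ray_image_neq0 _) dr e0.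
rewrite in_itv/= andbT in v0.
have := mdist_normB o (beta r) (alpha v).
rewrite (geodesic_ray_norm bg)// (geodesic_ray_norm ag)// -(geodesic_rayE ag)//.
have := metric_triangle (alpha r) (alpha v) (beta r).
rewrite /gromov_product !(metric_sym _ o) (geodesic_ray_norm bg)//.
by rewrite (geodesic_ray_norm ag)// (metric_sym (alpha v)); lra.
Qed.

Lemma identified_rep a a' : identified o kappa a a' ->
  [/\ visual_boundary o a, kappa_boundary o kappa a',
      geodesic_ray o (rep a'), is_ray o (rep a') & a (rep a') /\ a' (rep a')].
Proof.
move=> [va ka [alpha [ag aa a'a]]]; have [rg ra] := rep_geodesic ka.
have rr := kappa_boundary_ray ka ra.
split=> //; split=> //; apply: (visual_boundary_mem va aa rr).
apply: (finite_hausdorff_rays (D := 4 * delta)) => u u0.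
exact: (kappa_boundary_rays delta_ge0 X_hyperbolic ag rg ka a'a ra u0).
Qed.

Lemma identified_inj a b a' : identified o kappa a a' ->
  identified o kappa b a' -> a = b.
Proof.
move=> /identified_rep[va _ _ _ [aa _]] /identified_rep[vb _ _ _ [ba _]].
apply: (visual_boundary_eq va vb aa ba).
by apply: (finite_hausdorff_rays (D := 0)) => u _; rewrite mdistxx.
Qed.

Lemma boundary_product_fin a b alpha beta : a <> b ->
  visual_boundary o a -> visual_boundary o b ->
  geodesic_ray o alpha -> a alpha -> geodesic_ray o beta -> b beta ->
  exists2 g, boundary_product o a b = g%:E & 0 <= g.
Proof.
move=> ab va vb ag aa bg bb.
have := @boundary_product_ge _ _ o a b alpha beta 0 0 ab ag aa bg bb.
have /[swap] /[apply] : forall s t : R, 0 <= s -> 0 <= t -> 0 <= s -> 0 <= t ->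
    0 <= gromov_product o (alpha s) (beta t).
  by move=> *; exact: gromov_product_ge0.
case bp : (boundary_product o a b) => [g| |//]; first by exists g.
move=> _; exfalso; apply: (ab); apply: (visual_boundary_eq va vb aa bb).
apply: (finite_hausdorff_rays (D := 4 * delta)) => u u0.
have [|N hN] := @boundary_product_lt _ _ o delta a b alpha beta (u + 2 * delta)
  delta_ge0 X_hyperbolic ab va vb ag aa bg bb; first by rewrite bp ltry.
pose t := Num.max u N; have ut : u <= t by rewrite le_max lexx.
have Nt : N <= t by rewrite le_max lexx orbT.
have t0 : 0 <= t by lra.
rewrite -[4 * delta]add0r -[X in X + _](mulr0 2).
apply: (fellow_travel_rays delta_ge0 X_hyperbolic ag bg (s := t) (t := t)) => //.
by apply: le_trans (hN t t t0 t0 Nt Nt); lra.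
Qed.

Lemma fellow_sup_ge alpha b g :
  (forall r, 0 < r -> r < g -> fellow_set o kappa M alpha r b) ->
  (g%:E <= fellow_sup o kappa M alpha b)%E.
Proof.
move=> h; have [g0|g0] := leP g 0.
  by apply: (@le_trans _ _ 0%E); rewrite ?lee_fin// le_max lexx.
rewrite leNgt; apply/negP; rewrite /fellow_sup gt_max => /andP[_ /[dup] sg].
apply/negP; rewrite -leNgt; apply/lee_subgt0Pr => e e0.
have [ge|ge] := leP g e.
  apply: (@le_trans _ _ (g / 2)%:E); first by rewrite -EFinB lee_fin; lra.
  by apply: ereal_sup_ubound; exists (g / 2) => //; split; [lra | apply: h; lra].
apply: ereal_sup_ubound; exists (g - e) => //.
by split; [lra | apply: h; lra].
Qed.

Lemma fellow_radius_bounds : exists2 C, 1 <= C & forall a b a' b',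
  identified o kappa a a' -> identified o kappa b b' -> a <> b ->
  a' <> b' /\ exists g r, [/\ boundary_product o a b = g%:E, ro a' b' = r%:E,
    0 <= g, g <= r & r <= g + C * kappa g + C].
Proof.
have [M1 _] := morse_const_ge 1 0; have M0 : 0 < M 1 0 by lra.
have [r0 r00 hr0] := sublinear_bound kappa_sublinear M0.
exists (2 * M 1 0 + r0); first by lra.
move=> a b a' b' ia ib ab.
have ab' : a' <> b' by move=> ab'; apply: ab; apply: identified_inj ia _; rewrite ab'.
split=> //.
have [va ka ag ar [aa a'a]] := identified_rep ia.
have [vb kb bg br [bb b'b]] := identified_rep ib.
set alpha := rep a' in ag ar aa a'a; set beta := rep b' in bg br bb b'b.
have [g bp g0] := boundary_product_fin ab va vb ag aa bg bb.
have lt_g r : r < g -> exists N, forall s t, 0 <= s -> 0 <= t -> N <= s ->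
    N <= t -> r - 2 * delta <= gromov_product o (alpha s) (beta t).
  move=> rg; apply: boundary_product_lt aa bg bb _ => //.
  by rewrite bp lte_fin.
have lower : (g%:E <= ro a' b')%E.
  rewrite /ro /fellow_radius; case: asboolP => // _; rewrite le_min.
  apply/andP; split; apply: fellow_sup_ge => r rp /lt_g[N hN].
    apply: (fellow_set_near ka bg ag a'a rp); exists N => s t s0 t0 Ns Nt.
    by rewrite gromov_productC; exact: hN.
  by apply: (fellow_set_near kb ag bg b'b rp); exists N.
have kg := sublinear_ge1 kappa_sublinear g0.
have upper : (ro a' b' <= (g + (2 * M 1 0 + r0) * kappa g + (2 * M 1 0 + r0))%:E)%E.
  rewrite /ro /fellow_radius; case: asboolP => // _.
  rewrite ge_min; apply/orP; right; rewrite /fellow_sup ge_max lee_fin.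
  have Mk : 0 <= M 1 0 * kappa g by apply: mulr_ge0; lra.
  have rk : 0 <= r0 * kappa g by apply: mulr_ge0; lra.
  apply/andP; split; first by lra.
  apply: ge_ereal_sup => _ [r [rp fr] <-]; rewrite lee_fin.
  have [rr0|r0r] := leP r r0; first by lra.
  have Mr := hr0 _ r0r; have kr := sublinear_ge1 kappa_sublinear (ltW rp).
  have := fellow_set_product ag bg br b'b rp Mr fr.
  move=> hr; have rg : r - M 1 0 * kappa r <= g.
    rewrite -lee_fin -bp; apply: (boundary_product_ge (N := r) ab ag aa bg bb).
    move=> s t s0 t0 rs rt; apply: le_trans hr _.
    exact: gromov_product_rays_mono (ltW rp) rs rt.
  have : M 1 0 * (24 * kappa r) < r by rewrite -ltr_pdivlMr//; lra.
  move=> Mkr; have r2g : r <= 2 * g by lra.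
  have : kappa r <= 2 * kappa g.
    apply: le_trans (sublinear_double kappa_sublinear g0).
    exact: (sublinear_le kappa_sublinear (ltW rp) r2g).
  move=> /(ler_wpM2l (ltW M0)) krg; lra.
have : ro a' b' \is a fin_num.
  rewrite fin_numE; apply/andP; split; apply/eqP => h.
    by move: lower; rewrite h.
  by move: upper; rewrite h.
move=> /fineK roE; exists g, (fine (ro a' b')).
by rewrite -!lee_fin roE.
Qed.

End FellowRadius.

Section LogScale.
Context {R : realType}.
Implicit Types (r g c theta K : R).

Lemma exprz_floor_log r : 0 < r ->
  2 ^ Num.floor (ln r / ln 2) <= r < 2 * 2 ^ Num.floor (ln r / ln 2).
Proof.
move=> r0; set n := Num.floor _.
have l2 : 0 < ln 2 :> R by rewrite ln_gt0// ltr1n.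
have E (z : int) : 2 ^ z = expR (z%:~R * ln 2) :> R.
  by rewrite -powR_intmul// /powR (negbTE (lt0r_neq0 _)).
have -> : 2 * 2 ^ n = 2 ^ (n + 1) :> R by rewrite expfzDr// expr1z mulrC.
rewrite !E -[X in _ <= X < _]lnK ?posrE// ler_expR ltr_expR.
by rewrite -ler_pdivlMr// -ltr_pdivrMr// floor_itv.
Qed.

Lemma log_scale_bounds (T : Type) (rad : T -> T -> \bar R) (a b : T) r :
  a <> b -> rad a b = r%:E -> 0 <= r ->
  (1 + r)^-1 <= log_scale rad a b <= 6 * (1 + r)^-1.
Proof.
move=> ab rE r0; rewrite /log_scale; case: asboolP => // _.
have r1 : 0 < 1 + r by lra.
rewrite rE lte_fin ler_pdivlMr// -[X in X <= _]mul1r ler_pdivrMr//.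
case: ltP => r2; first by apply/andP; split; lra.
have rp : 0 < r by lra.
have := exprz_floor_log rp; rewrite /=; set n := Num.floor _.
rewrite expfzDr// expr1z -invr_expz; set P := 2 ^ n => /andP[Pr rP].
have P0 : 0 < P by rewrite exprz_gt0.
rewrite mulrAC -mulrA; apply/andP; split.
  by rewrite mulrC ler_pdivlMr//; lra.
by rewrite mulrC ler_pdivrMr//; lra.
Qed.

Lemma powRV x theta : 0 <= x -> x^-1 `^ theta = (x `^ theta)^-1.
Proof. by move=> x0; rewrite -(powR_inv1 x0) -powRrM mulN1r powRN. Qed.

End LogScale.

Lemma comparable_powR {R : realType} (theta K c s d G : R) :
  0 <= theta -> 1 <= K -> 1 <= c -> 0 < G ->
  K^-1 * G^-1 <= s -> s <= K * G^-1 ->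
  comparable_by c d%:E (s `^ theta)%:E ->
  comparable_by (c * K `^ theta) d%:E ((G `^ theta)^-1)%:E.
Proof.
move=> t0 K1 c1 G0 Ks sK []; rewrite -!EFinM !lee_fin => h1 h2.
have K0 : 0 <= K by lra.
have c0 : 0 <= c by lra.
have KG : 0 <= K^-1 * G^-1 by rewrite mulr_ge0 ?invr_ge0// ltW.
have KG' : 0 <= K * G^-1 by rewrite mulr_ge0 ?invr_ge0// ltW.
have s0 : 0 <= s := le_trans KG Ks.
have KV : 0 <= K^-1 by rewrite invr_ge0.
have GV : 0 <= G^-1 by rewrite invr_ge0 ltW.
split; rewrite -EFinM lee_fin -(powRV _ (ltW G0)).
- apply: le_trans h1; rewrite invfM -mulrA ler_wpM2l ?invr_ge0//.
  by rewrite -powRV// -powRM//; apply: ge0_ler_powR.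
- apply: (le_trans h2); rewrite -mulrA ler_wpM2l//.
  by rewrite -powRM//; apply: ge0_ler_powR.
Qed.

Theorem theorem1 (R : realType) (X : metricType R) (o : X) (delta : R)
    (kappa : R -> R) (H : R -> R -> R -> R) (rep : set (R -> X) -> R -> X)
    (X_proper : proper_space X) (X_geodesic : geodesic_space X)
    (delta_ge0 : 0 <= delta) (X_hyperbolic : hyperbolic X delta)
    (kappa_sublinear : sublinear kappa)
    (H_morse : morse_bound o (H delta))
    (rep_geodesic : geodesic_representatives o kappa rep) :
  let ro := fellow_radius o kappa (morse_const delta H) rep in
  [/\ exists2 C : R, 1 <= C & forall a b a' b' : set (R -> X),
        identified o kappa a a' -> identified o kappa b b' -> a <> b ->
        [/\ boundary_product o a b \is a fin_num,
            (boundary_product o a b <= ro a' b')%E &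
            (ro a' b' <= boundary_product o a b
               + (C * kappa (fine (boundary_product o a b)))%:E + C%:E)%E],
      exists2 c : R, 1 <= c & forall a b a' b' : set (R -> X),
        identified o kappa a a' -> identified o kappa b b' -> a <> b ->
        comparable_by c (1 + ro a' b')%E (1 + boundary_product o a b)%E
    & forall (theta : R) (d : set (R -> X) -> set (R -> X) -> R),
        admissible theta -> log_metric (kappa_boundary o kappa) ro theta d ->
        exists2 c : R, 1 <= c & forall a b a' b' : set (R -> X),
          identified o kappa a a' -> identified o kappa b b' -> a <> b ->
          comparable_by c (d a' b')%:E
            (((1 + fine (boundary_product o a b)) `^ theta)^-1)%:E].
Proof.
move=> ro; rewrite {}/ro; have [C C1 bounds] := fellow_radius_bounds X_geodesic delta_ge0
  X_hyperbolic kappa_sublinear H_morse rep_geodesic.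
have k1 := sublinear_ge1 kappa_sublinear ler01.
pose c := 1 + C * kappa 1 + C.
have Ck : 0 <= C * kappa 1 by apply: mulr_ge0; lra.
have c1 : 1 <= c by rewrite /c; lra.
have linear g r : 0 <= g -> r <= g + C * kappa g + C -> 1 + r <= c * (1 + g).
  move=> g0 rg; have := sublinear_linear kappa_sublinear g0.
  move=> /(ler_wpM2l (le_trans ler01 C1)) kg.
  have : 0 <= C * g by apply: mulr_ge0; lra.
  by rewrite /c; lra.
split.
- exists C => // a b a' b' ia ib ab.
  have [_ [g [r [-> -> g0 gr rg]]]] := bounds _ _ _ _ ia ib ab.
  by split=> //; rewrite ?lee_fin//= -!EFinD lee_fin.
- exists c => // a b a' b' ia ib ab.
  have [_ [g [r [-> -> g0 gr rg]]]] := bounds _ _ _ _ ia ib ab.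
  split; rewrite -!EFinD -EFinM lee_fin; last exact: linear.
  rewrite mulrC ler_pdivrMr; last by lra.
  by apply: (@le_trans _ _ (1 + r)); [lra | rewrite ler_peMr//; lra].
- move=> theta d /andP[theta0 _] [_ [c0 c01 dc]].
  pose K := Num.max 6 c; have K6 : 6 <= K by rewrite le_max lexx.
  have Kc : c <= K by rewrite le_max lexx orbT.
  have K1 : 1 <= K by lra.
  exists (c0 * K `^ theta).
    apply: mulr_ege1 => //; rewrite -(powRr0 K); apply: ler_powR => //.
    exact: ltW.
  move=> a b a' b' ia ib ab; have [_ ka _] := ia; have [_ kb _] := ib.
  have [ab' [g [r [-> rE g0 gr rg]]]] := bounds _ _ _ _ ia ib ab.
  have r0 : 0 <= r by lra.
  have /andP[s1 s2] := log_scale_bounds ab' rE r0.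
  have g1 : 0 < 1 + g by lra.
  have r1 : 0 < 1 + r by lra.
  apply: comparable_powR (dc _ _ ka kb) => //; first exact: ltW.
  + apply: le_trans s1; rewrite -invfM lef_pV2 ?posrE ?mulr_gt0//; last by lra.
    apply: le_trans (linear _ _ g0 rg) _.
    by rewrite ler_pM2r.
  + apply: (le_trans s2); apply: ler_pM => //; first by rewrite invr_ge0 ltW.
    by rewrite lef_pV2 ?posrE// lerD2l.
Qed.
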